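(* There is no functor $M:\mathfrak{H}\to\mathbf{Gra}$ such that $M(G)=L(G)$ for all set-system hypergraphs $G$.
   Context: $\mathcal{P}$ denotes the covariant power-set functor on sets, with $\mathcal P(f)(A)=\{f(x):x\in A\}$. A set-system hypergraph is a triple $G=(E(G),\epsilon_G,V(G))$, where $E(G)$ (edges) and $V(G)$ (vertices) are sets and $\epsilon_G:E(G)\to\mathcal P(V(G))$ is a function. The category $\mathfrak H$ has set-system hypergraphs as objects; a morphism $\phi:G\to H$ is a pair of functions $E(\phi):E(G)\to E(H)$, $V(\phi):V(G)\to V(H)$ with $\epsilon_H(E(\phi)(e))=\mathcal P(V(\phi))(\epsilon_G(e))$ for all $e\in E(G)$. The category $\mathbf{Gra}$: objects are graphs $G=(V(G),E(G))$, with $V(G)$ a set and $E(G)\subseteq\mathcal P(V(G))$ such that every $A\in E(G)$ has $1\le\operatorname{card}(A)\le 2$; a morphism $f:G\to G'$ is a function $f:V(G)\to V(G')$ such that $A\in E(G)$ implies $\mathcal P(f)(A)\in E(G')$. Intersection graph: for a set-system hypergraph $G$, $L(G)$ is the graph with vertex set $E(G)$ and edge set $\{\{e,f\}: e\neq f,\ \epsilon_G(e)\cap\epsilon_G(f)\neq\emptyset\}$ (with $e,f\in E(G)$). *)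

(* Defs.v *)
From mathcomp Require Import all_boot.
From mathcomp Require Import boolp classical_sets functions cardinality.

Set Implicit Arguments.
Unset Strict Implicit.
Unset Printing Implicit Defensive.

Local Open Scope classical_set_scope.
Local Open Scope card_scope.

Record category := Category {
  obj :> Type;
  hom : obj -> obj -> Type;
  idm : forall a : obj, hom a a;
  comp : forall a b c : obj, hom b c -> hom a b -> hom a c;
  comp_idl : forall (a b : obj) (f : hom a b), comp (idm b) f = f;
  comp_idr : forall (a b : obj) (f : hom a b), comp f (idm a) = f;
  compA : forall (a b c d : obj) (h : hom c d) (g : hom b c) (f : hom a b),
    comp h (comp g f) = comp (comp h g) f
}.

Record functor (C D : category) := Functor {
  fobj :> C -> D;
  fmap : forall a b : C, hom a b -> hom (fobj a) (fobj b);
  fmap_id : forall a : C, fmap (idm a) = idm (fobj a);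
  fmap_comp : forall (a b c : C) (g : hom b c) (f : hom a b),
    fmap (comp g f) = comp (fmap g) (fmap f)
}.

(* The vertex and edge sets are arbitrary types, possibly empty or infinite,  *)
(* and the power set of V is set V.                                           *)
Record hypergraph := Hypergraph {
  hedge : Type;
  hvertex : Type;
  heps : hedge -> set hvertex
}.

Record hypergraph_hom (G H : hypergraph) := HypergraphHom {
  hom_edge : hedge G -> hedge H;
  hom_vertex : hvertex G -> hvertex H;
  hom_eps : forall e : hedge G,
    heps (hom_edge e) = hom_vertex @` heps e
}.

Lemma hypergraph_hom_eq (G H : hypergraph) (f g : hypergraph_hom G H) :
  hom_edge f = hom_edge g -> hom_vertex f = hom_vertex g -> f = g.
Proof.
case: f g => [fe fv fP] [ge gv gP] /= efg vfg; subst ge gv.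
by congr HypergraphHom; exact: Prop_irrelevance.
Qed.

Lemma hypergraph_id_subproof (G : hypergraph) (e : hedge G) :
  heps (id e) = id @` heps e.
Proof. by rewrite image_id. Qed.

Definition hypergraph_id (G : hypergraph) : hypergraph_hom G G :=
  HypergraphHom (@hypergraph_id_subproof G).

Lemma hypergraph_comp_subproof (G H K : hypergraph) (g : hypergraph_hom H K)
    (f : hypergraph_hom G H) (e : hedge G) :
  heps ((hom_edge g \o hom_edge f) e) =
  (hom_vertex g \o hom_vertex f) @` heps e.
Proof. by rewrite /= !hom_eps image_comp. Qed.

Definition hypergraph_comp (G H K : hypergraph) (g : hypergraph_hom H K)
    (f : hypergraph_hom G H) : hypergraph_hom G K :=
  HypergraphHom (hypergraph_comp_subproof g f).

Lemma hypergraph_comp_idl (G H : hypergraph) (f : hypergraph_hom G H) :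
  hypergraph_comp (hypergraph_id H) f = f.
Proof. exact: hypergraph_hom_eq. Qed.

Lemma hypergraph_comp_idr (G H : hypergraph) (f : hypergraph_hom G H) :
  hypergraph_comp f (hypergraph_id G) = f.
Proof. exact: hypergraph_hom_eq. Qed.

Lemma hypergraph_compA (G H K L : hypergraph) (h : hypergraph_hom K L)
    (g : hypergraph_hom H K) (f : hypergraph_hom G H) :
  hypergraph_comp h (hypergraph_comp g f) = hypergraph_comp (hypergraph_comp h g) f.
Proof. exact: hypergraph_hom_eq. Qed.

Definition HypergraphCat : category :=
  Category hypergraph_comp_idl hypergraph_comp_idr hypergraph_compA.

Record graph := Graph {
  vertex : Type;
  edges : set (set vertex);
  edges_card : forall A : set vertex, edges A -> `I_1 #<= A /\ A #<= `I_2
}.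

Record graph_hom (G H : graph) := GraphHom {
  graph_fun :> vertex G -> vertex H;
  graph_funP : forall A : set (vertex G), edges A -> edges (graph_fun @` A)
}.

Lemma graph_hom_eq (G H : graph) (f g : graph_hom G H) :
  graph_fun f = graph_fun g -> f = g.
Proof.
case: f g => [f fP] [g gP] /= fg; subst g.
by congr GraphHom; exact: Prop_irrelevance.
Qed.

Lemma graph_id_subproof (G : graph) (A : set (vertex G)) :
  edges A -> edges (id @` A).
Proof. by rewrite image_id. Qed.

Definition graph_id (G : graph) : graph_hom G G :=
  GraphHom (@graph_id_subproof G).

Lemma graph_comp_subproof (G H K : graph) (g : graph_hom H K)
    (f : graph_hom G H) (A : set (vertex G)) :
  edges A -> edges ((g \o f) @` A).
Proof. by move=> EA; rewrite -image_comp; do 2 apply: graph_funP. Qed.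

Definition graph_comp (G H K : graph) (g : graph_hom H K)
    (f : graph_hom G H) : graph_hom G K :=
  GraphHom (graph_comp_subproof g f).

Lemma graph_comp_idl (G H : graph) (f : graph_hom G H) :
  graph_comp (graph_id H) f = f.
Proof. exact: graph_hom_eq. Qed.

Lemma graph_comp_idr (G H : graph) (f : graph_hom G H) :
  graph_comp f (graph_id G) = f.
Proof. exact: graph_hom_eq. Qed.

Lemma graph_compA (G H K L : graph) (h : graph_hom K L)
    (g : graph_hom H K) (f : graph_hom G H) :
  graph_comp h (graph_comp g f) = graph_comp (graph_comp h g) f.
Proof. exact: graph_hom_eq. Qed.

Definition Gra : category :=
  Category graph_comp_idl graph_comp_idr graph_compA.

Definition intersection_edges (G : hypergraph) : set (set (hedge G)) :=
  [set [set p.1; p.2] | p in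
    [set p : hedge G * hedge G |
      p.1 <> p.2 /\ heps p.1 `&` heps p.2 !=set0]].

Lemma intersection_edges_card (G : hypergraph) (A : set (hedge G)) :
  intersection_edges A -> `I_1 #<= A /\ A #<= `I_2.
Proof.
move=> [[e f] /= _ <-]; split.
  have : [set e] #<= [set e; f] by apply: subset_card_le => x ->; left.
  by apply: card_le_trans; have := @card_set1 _ e; rewrite card_eq_le => /andP[].
have -> : [set e; f] = (fun n => if n is 0 then e else f) @` `I_2.
  apply/seteqP; split => x /=.
    by case=> ->; [exists 0 | exists 1].
  by case=> -[|n] _ <-; [left | right].
exact: card_image_le.
Qed.

Definition intersection_graph (G : hypergraph) : graph :=
  Graph (@intersection_edges_card G).

(* Main.v *)
(* If e and f are parallel nonempty edges, then e and f are adjacent in L(G).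
   Identifying them is a morphism of set-system hypergraphs, but L(G) never has
   loops, so already there is no graph morphism at all from L of two parallel
   edges to L of a single edge, whatever M does on morphisms. *)
From mathcomp Require Import all_boot.
From mathcomp Require Import classical_sets.
Require Import Defs.

Local Open Scope classical_set_scope.

(** With one vertex lying on all edges, any two edges meet, and every function [I -> J] between edge
    sets is a morphism over the identity on vertices. *)
Definition parallel_edges (I : Type) : hypergraph :=
  @Hypergraph I unit (fun=> setT).

Lemma merge_edges_subproof (I J : Type) (h : I -> J) (i : hedge (parallel_edges I)) :
  heps (h i : hedge (parallel_edges J)) = id @` heps i.
Proof. by rewrite image_id. Qed.

Definition merge_edges (I J : Type) (h : I -> J) :
    hypergraph_hom (parallel_edges I) (parallel_edges J) :=
  HypergraphHom (merge_edges_subproof I J h).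

Lemma intersection_graph_no_hom :
  graph_hom (intersection_graph (parallel_edges bool))
            (intersection_graph (parallel_edges unit)) -> False.
Proof.
move=> f.
have adj : @edges (intersection_graph (parallel_edges bool)) [set true; false].
  by exists (true, false) => //; split => //; exists tt.
(* The image edge would have to come from a pair of distinct elements of [unit], but the only pair
   is [(tt, tt)]. *)
by case: (graph_funP f adj) => -[[] []] /= [].
Qed.

Theorem proposition2p13 :
  ~ exists M : functor HypergraphCat Gra,
      forall G : hypergraph, M G = intersection_graph G.
Proof.
case=> M ML.
have : graph_hom (M (parallel_edges bool)) (M (parallel_edges unit)).
  exact: (@fmap _ _ M (parallel_edges bool) (parallel_edges unit)
                      (merge_edges bool unit (fun=> tt))).
(* Rewriting along [ML] transports only the type of this morphism; mere existence is already
   contradictory. *)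
by rewrite !ML; exact: intersection_graph_no_hom.
Qed.
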